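(* Let $S\subset\mathbb{R}^2$ be a set of $n\ge 1$ points in general position. Then there exists a $\frac{3\pi}{2}$-open plane straight-line spanning tree $T$ of $S$ such that every point of $S$ has vertex degree at most three in $T$. Moreover, the angle bound is best possible, even for the broader class of spanning trees of vertex degree at most $n-2$: for every positive integer $n$ and every $\varepsilon>0$ there exists a set $S\subset\mathbb{R}^2$ of $n$ points in general position such that every plane straight-line spanning tree $T$ of $S$ in which every vertex has degree at most $n-2$ satisfies $\mathrm{op}(T)<\frac{3\pi}{2}+\varepsilon$.
   Context: A finite set $S\subset\mathbb{R}^2$ is in general position if no three of its points are collinear. A plane straight-line graph $G=(S,E)$ on $S$ has vertex set $S$, its edges are straight-line segments connecting two points of $S$, and two edges do not intersect except possibly at common endpoints. A plane straight-line spanning tree of $S$ is a plane straight-line graph on $S$ that is a tree with vertex set $S$. The incident angles of $p\in S$ in $G$ are the angles between two edges of $G$ that appear consecutively in the circular order of the edges incident to $p$ (so for a vertex of degree at least two they sum to $2\pi$). The openness $\mathrm{op}_G(p)$ of $p$ in $G$ is the maximum incident angle of $p$ in $G$; if $p$ has degree at most one, set $\mathrm{op}_G(p)=2\pi$. The openness of $G$ is $\mathrm{op}(G)=\min_{p\in S}\mathrm{op}_G(p)$, and $G$ is called $\varphi$-open if $\mathrm{op}(G)\ge\varphi$. *)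

(* Defs.v *)
From HB Require Import structures.
From mathcomp Require Import all_boot all_order all_algebra finmap.
From mathcomp Require Import all_classical all_reals all_analysis.
Set Implicit Arguments.
Unset Strict Implicit.
Unset Printing Implicit Defensive.
Import Order.TTheory GRing.Theory Num.Theory.
Import numFieldNormedType.Exports.
Local Open Scope ring_scope.

Section Plane.
Variable R : realType.
Implicit Types p q r u v : R * R.

Definition dot u v : R := u.1 * v.1 + u.2 * v.2.
Definition cross u v : R := u.1 * v.2 - u.2 * v.1.

(* The library norm on R * R is the maximum norm. *)
Definition enorm u : R := Num.sqrt (dot u u).

Definition on_common_line p q r : Prop :=
  exists a b c : R, (a, b) != (0, 0) /\
    [/\ a * p.1 + b * p.2 = c, a * q.1 + b * q.2 = c & a * r.1 + b * r.2 = c].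

Definition general_position (S : {fset R * R}) : Prop :=
  forall p q r, p \in S -> q \in S -> r \in S ->
    p != q -> q != r -> p != r -> ~ on_common_line p q r.

Definition segment p q (z : R * R) : Prop :=
  exists2 t : R, 0 <= t <= 1 & z = (1 - t) *: p + t *: q.

(* For nonzero u and v, the counterclockwise angle from u to v, in [0, 2 pi[. *)
Definition ccw_angle u v : R :=
  let a := acos (dot u v / (enorm u * enorm v)) in
  if 0 <= cross u v then a else 2 * pi - a.

End Plane.

(* A straight-line graph on S is given by its adjacency relation e : rel S;
   the edge between x and y is the segment from val x to val y. *)
Section Graph.
Variables (R : realType) (S : {fset R * R}) (e : rel S).
Implicit Types p q r s x y : S.

Definition plane_graph : Prop :=
  [/\ symmetric e, irreflexive e
    & forall x1 y1 x2 y2, e x1 y1 -> e x2 y2 -> [set x1; y1] != [set x2; y2] ->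
        forall z : R * R,
          segment (val x1) (val y1) z -> segment (val x2) (val y2) z ->
          exists2 w : S, w \in [set x1; y1] :&: [set x2; y2] & z = val w].

(* A closed walk with distinct vertices is a genuine cycle only from length 3
   on: an edge traversed back and forth is one of length 2. *)
Definition acyclic : Prop :=
  forall c : seq S, uniq c -> cycle e c -> (size c <= 2)%N.

Definition plane_spanning_tree : Prop :=
  [/\ plane_graph, forall x y, connect e x y & acyclic].

Definition degree p : nat := #|[set q | e p q]|.

Definition angle_at p q r : R := ccw_angle (val q - val p) (val r - val p).

(* pr is the edge following pq in counterclockwise order around p. When p has
   degree two, each of its two edges follows the other. *)
Definition next_edge p q r : bool :=
  [&& e p q, e p r, q != r
    & [forall s, (e p s && (s != q)) ==> (angle_at p q r <= angle_at p q s)]].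

(* Angles are nonnegative, so the default 0 does not affect the maximum. *)
Definition vertex_openness p : R :=
  if (degree p <= 1)%N then 2 * pi
  else \big[Num.max/0]_(qr : S * S | next_edge p qr.1 qr.2)
         angle_at p qr.1 qr.2.

(* vertex_openness is at most 2 pi, so the default 2 pi does not affect the
   minimum when S is nonempty. *)
Definition openness : R := \big[Num.min/(2 * pi)]_(p : S) vertex_openness p.

Definition is_open (phi : R) : Prop := phi <= openness.

End Graph.

(* Main.v *)
Require Import Defs.
From mathcomp Require Import all_boot all_order all_algebra finmap.
From mathcomp Require Import all_classical all_reals all_analysis.
From mathcomp Require Import ring lra.
Local Open Scope ring_scope.
Import Order.TTheory GRing.Theory Num.Theory.
Set Implicit Arguments.
Unset Strict Implicit.
Unset Printing Implicit Defensive.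

(** A tree is 3pi/2-open as soon as any two edges at a common vertex form a
    non-obtuse angle. Call a point a of A sharp if A lies in a closed right angle
    with apex a. By induction on #|A|, prove simultaneously: (1) if a is sharp,
    A has a good tree in which a has degree at most 1; (2) if a and b are both
    sharp, A has one in which a has degree at most 1 and b at most 2. Every step
    picks an edge ef, gives one side of the line ef to e and the other to f so
    that e and f are sharp in their parts, and joins the two trees by ef.
    For (1), ef is a diameter of A minus a, the side of a going to the endpoint
    at which the angle towards a is not obtuse. For (2), if A lies on one side
    of the line ab, the edge ab with everything given to b will do; otherwise
    take the longest segment pq with endpoints on different sides of ab: since
    apb and aqb are less than pi, either p can take the side of a and q the side
    of b, or conversely. The theorem follows by (1) applied to both sides of a
    diameter.
    For the converse, put all points but one on a short, almost straight arc
    seen almost orthogonally from the remaining point o: a spanning tree that is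
    not a star around o has a vertex adjacent to o and to another point of the
    arc, and the angle there is almost a right one. *)

(** * Dot and cross products in the plane *)

Section Vectors.
Variable R : realType.
Implicit Types (s : R) (u v w x y z : R * R).

Lemma dotBE x y z :
  dot (y - x) (z - x) = (y.1 - x.1) * (z.1 - x.1) + (y.2 - x.2) * (z.2 - x.2).
Proof. by []. Qed.

Lemma crossBE x y z :
  cross (y - x) (z - x) = (y.1 - x.1) * (z.2 - x.2) - (y.2 - x.2) * (z.1 - x.1).
Proof. by []. Qed.

Lemma dot_ge0 v : 0 <= dot v v.
Proof. by apply: addr_ge0; rewrite -expr2 sqr_ge0. Qed.

Lemma dot_eq0 v : (dot v v == 0) = (v == 0).
Proof. by case: v => a b; rewrite /dot paddr_eq0 -?expr2 ?sqr_ge0// !sqrf_eq0. Qed.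

Lemma dot_gt0 v : (0 < dot v v) = (v != 0).
Proof. by rewrite lt_def dot_ge0 dot_eq0 andbT. Qed.

Lemma dotC u v : dot u v = dot v u.
Proof. by rewrite /dot mulrC [X in _ + X]mulrC. Qed.

(* With vectors read as complex numbers, [dot x y + i cross x y] is [x^* y];
   this and [crossM] are the two parts of [(v^* v) (x^* y) = (v^* x)^* (v^* y)]. *)
Lemma dotM v x y : dot v v * dot x y = dot v x * dot v y + cross v x * cross v y.
Proof. by rewrite /dot /cross; ring. Qed.

Lemma crossM v x y : dot v v * cross x y = dot v x * cross v y - cross v x * dot v y.
Proof. by rewrite /dot /cross; ring. Qed.

(** Both terms of [dotM] are nonnegative: [x] and [y] lie in the same quadrant cut out by [v] and
    its normal. *)
Lemma dot_same_side v x y : 0 <= dot v x -> 0 <= dot v y ->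
  0 < cross v x * cross v y -> 0 <= dot x y.
Proof.
move=> vx vy vxy.
have : 0 < dot v v * dot x y by rewrite dotM ltr_wpDl ?mulr_ge0.
have := dot_ge0 v; nra.
Qed.

(** Law of cosines: in the triangle [xyz] the angle at [y] faces [xz], which is no longer than [xy],
    so it cannot be obtuse. *)
Lemma dot_ge0_longest x y z : dot (z - x) (z - x) <= dot (y - x) (y - x) ->
  0 <= dot (x - y) (z - y).
Proof.
rewrite !dotBE => h; have := dot_ge0 (z - y); rewrite /dot /=.
by have := sqr_ge0 (z.1 - y.1); have := sqr_ge0 (z.2 - y.2); nra.
Qed.

(* Cramer's rule for [y] in the basis [v], [w], multiplied by [v]. *)
Lemma dot_cramer v w y :
  cross w v * dot v y = cross w y * dot v v - cross v y * dot v w.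
Proof. by rewrite /dot /cross; ring. Qed.

End Vectors.

(** * Joining two trees by an edge *)

Section Tree.
Variables (R : realType) (S : {fset R * R}).
Implicit Types (A B : {set S}) (E F : rel S) (a b c d e f p q x y : S) (s : R).

Definition plane_edges E := forall x1 y1 x2 y2,
  E x1 y1 -> E x2 y2 -> [set x1; y1] != [set x2; y2] ->
  forall z : R * R,
    segment (val x1) (val y1) z -> segment (val x2) (val y2) z ->
    exists2 w : S, w \in [set x1; y1] :&: [set x2; y2] & z = val w.

(** A tree on a part [A] is still a relation on all of [S], so that trees on different parts can be
    united directly. *)
Definition tree_on E A :=
  [/\ [/\ symmetric E, irreflexive E & forall x y, E x y -> x \in A],
      plane_edges E, {in A &, forall x y, connect E x y} & acyclic E].

Definition nonobtuse E := forall p q r, E p q -> E p r ->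
  0 <= dot (val q - val p) (val r - val p).

Definition good E A :=
  [/\ tree_on E A, nonobtuse E & forall p, (degree E p <= 3)%N].

Definition join E F e f : rel S := fun x y =>
  [|| E x y, F x y, (x == e) && (y == f) | (x == f) && (y == e)].

Lemma good_single a : good [rel _ _ | false] [set a].
Proof.
split=> //; last first.
  by move=> p; rewrite leqW// leqW// leqW// leqn0 cards_eq0; apply/eqP/setP => x; rewrite !inE.
split=> //; first by move=> x y; rewrite !inE => /eqP-> /eqP->.
by case=> [|x [|y c]].
Qed.

(** Convexity. This keeps each tree on its side of the line [g = 0], which it touches only at its
    own endpoint of the new edge. *)
Lemma segment_halfplane (g : R * R -> R) A e x y (z : R * R) :
  (forall u v t, g ((1 - t) *: u + t *: v) = (1 - t) * g u + t * g v) ->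
  g (val e) = 0 -> {in A, forall p, p != e -> 0 < g (val p)} ->
  x \in A -> y \in A -> x != y -> segment (val x) (val y) z ->
  0 <= g z /\ (g z = 0 -> z = val e /\ e \in [set x; y]).
Proof.
move=> g_affine ge gA xA yA nxy [t /andP[t0 t1] ->]; rewrite g_affine.
have gx : 0 <= g (val x).
  by case: (eqVneq x e) => [->|/(gA _ xA)/ltW//]; rewrite ge.
have gy : 0 <= g (val y).
  by case: (eqVneq y e) => [->|/(gA _ yA)/ltW//]; rewrite ge.
have t1' : 0 <= 1 - t by rewrite subr_ge0.
split; first by rewrite addr_ge0 ?mulr_ge0.
move=> /eqP; rewrite paddr_eq0 ?mulr_ge0// !mulf_eq0 => /andP[].
case: (eqVneq x e) => [xe _|xe].
  have ye : y != e by rewrite -xe eq_sym.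
  rewrite [g _ == 0]gt_eqF ?gA// orbF => /eqP->.
  by rewrite subr0 scale1r scale0r addr0 xe !inE eqxx.
rewrite [g (val x) == 0]gt_eqF ?gA// orbF subr_eq0 => /eqP<-.
rewrite oner_eq0 /= => gy0.
have -> : y = e by apply/eqP; apply: contraT => /(gA _ yA); rewrite (eqP gy0) ltxx.
by rewrite subrr scale0r scale1r add0r !inE eqxx orbT.
Qed.

(** * Joining two trees separated by a line through [e] and [f] *)

Section Join.
Variables (E F : rel S) (A B : {set S}) (e f : S) (g : R * R -> R).
Hypothesis g_affine :
  forall u v t, g ((1 - t) *: u + t *: v) = (1 - t) * g u + t * g v.
Hypotheses (ge : g (val e) = 0) (gf : g (val f) = 0).
Hypotheses (eA : e \in A) (fB : f \in B) (nef : e != f).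
Hypothesis gA : {in A, forall x, x != e -> 0 < g (val x)}.
Hypothesis gB : {in B, forall x, x != f -> g (val x) < 0}.
Hypotheses (gE : good E A) (gF : good F B).

Let G := join E F e f.

Let AB x : x \in A -> x \in B -> False.
Proof.
move=> xA xB; case: (eqVneq x e) => [xe|xe]; last first.
  have := gA xA xe; case: (eqVneq x f) => [->|xf]; rewrite ?gf ?ltxx//.
  by have := gB xB xf; move=> /lt_trans H /H; rewrite ltxx.
by have := gB xB; rewrite xe ge ltxx => /(_ nef).
Qed.

Let Esym : symmetric E. Proof. by case: gE => -[[]]. Qed.
Let Fsym : symmetric F. Proof. by case: gF => -[[]]. Qed.
Let Eirr : irreflexive E. Proof. by case: gE => -[[]]. Qed.
Let Firr : irreflexive F. Proof. by case: gF => -[[]]. Qed.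
Let EA x y : E x y -> x \in A. Proof. by case: gE => -[[_ _ +] _ _ _] _ _; apply. Qed.
Let FB x y : F x y -> x \in B. Proof. by case: gF => -[[_ _ +] _ _ _] _ _; apply. Qed.
Let EA' x y : E x y -> y \in A. Proof. by rewrite Esym => /EA. Qed.
Let FB' x y : F x y -> y \in B. Proof. by rewrite Fsym => /FB. Qed.

Let Gsym : symmetric G.
Proof.
move=> x y; rewrite /G /join Esym Fsym; congr (_ || (_ || _)).
by rewrite orbC andbC [X in _ || X]andbC.
Qed.

Let Girr : irreflexive G.
Proof.
move=> x; rewrite /G /join Eirr Firr /=; case: (eqVneq x e) => //= [->|_].
  by rewrite (negPf nef).
by rewrite andbF.
Qed.

Let G_AA x y : x \in A -> y \in A -> G x y -> E x y.
Proof.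
move=> xA yA /or4P[] //; first by move=> /FB /(AB xA).
- by move=> /andP[_ /eqP yf]; case: (AB yA); rewrite yf.
- by move=> /andP[/eqP xf _]; case: (AB xA); rewrite xf.
Qed.

Let G_BB x y : x \in B -> y \in B -> G x y -> F x y.
Proof.
move=> xA yA /or4P[] //; first by move=> /EA /AB /(_ xA).
- by move=> /andP[/eqP xf _]; case: (@AB x); rewrite // xf.
- by move=> /andP[_ /eqP yf]; case: (@AB y); rewrite // yf.
Qed.

Let G_A x y : x \in A -> G x y -> y \in A \/ x = e /\ y = f.
Proof.
move=> xA /or4P[/EA'|/FB/(AB xA)//|/andP[/eqP-> /eqP->]|/andP[/eqP xf _]]; try by [left|right].
by case: (AB xA); rewrite xf.
Qed.

Let G_B x y : x \in B -> G x y -> y \in B \/ x = f /\ y = e.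
Proof.
move=> xB /or4P[/EA /AB /(_ xB)//|/FB'|/andP[/eqP xe _]|/andP[/eqP-> /eqP->]]; try by [left|right].
by case: (@AB x); rewrite // xe.
Qed.

(** Edges of [E] lie in [g >= 0], edges of [F] in [g <= 0], and [ef] on [g = 0]. Different kinds can
    thus meet only on the line, where [E] reaches [e] alone and [F] reaches [f] alone. *)
Lemma join_plane : plane_edges G.
Proof.
have irrE x y : E x y -> x != y by apply: contraTneq => ->; rewrite Eirr.
have irrF x y : F x y -> x != y by apply: contraTneq => ->; rewrite Firr.
have segA x y (z : R * R) : E x y -> segment (val x) (val y) z ->
    0 <= g z /\ (g z = 0 -> z = val e /\ e \in [set x; y]).
  by move=> Exy; apply: segment_halfplane g_affine ge gA _ _ _; rewrite ?(EA Exy) ?(EA' Exy) ?irrE.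
have segB x y (z : R * R) : F x y -> segment (val x) (val y) z ->
    g z <= 0 /\ (g z = 0 -> z = val f /\ f \in [set x; y]).
  move=> Fxy sz; have [|||||||h1 h2] := @segment_halfplane (fun u => - g u) B f x y z.
  - by move=> u v t; rewrite g_affine; ring.
  - by rewrite gf oppr0.
  - by move=> p pB pf; rewrite oppr_gt0 gB.
  - exact: FB Fxy.
  - exact: FB' Fxy.
  - exact: irrF.
  - exact: sz.
  by split=> [|gz]; [rewrite -oppr_ge0|apply: h2; rewrite gz oppr0].
have segef x y (z : R * R) : (x == e) && (y == f) || (x == f) && (y == e) ->
    segment (val x) (val y) z -> g z = 0 /\ [set x; y] = [set e; f].
  move=> xy [t _ ->]; rewrite g_affine.
  by case/orP: xy => /andP[/eqP-> /eqP->]; rewrite ge gf !mulr0 addr0; split=> //; exact: finset.setUC.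
have EF x1 y1 x2 y2 (z : R * R) : E x1 y1 -> F x2 y2 -> segment (val x1) (val y1) z ->
    segment (val x2) (val y2) z -> False.
  move=> /segA h1 /segB h2 /h1[g0 ze] /h2[g1 zf].
  have gz : g z = 0 by apply/le_anti; rewrite g0 g1.
  by have [/eqP] := (ze gz, zf gz).1; rewrite (zf gz).1 eq_sym (inj_eq val_inj) (negPf nef).
move=> x1 y1 x2 y2; rewrite /G /join ![_ || (_ || (_ || _))]orbA.
move=> /orP[/orP[G1|G1]|G1] /orP[/orP[G2|G2]|G2] ne z z1 z2.
- by case: gE => -[_ + _ _] _ _; apply; eassumption.
- by case: (EF x1 y1 x2 y2 z).
- have [gz s2] := segef _ _ _ G2 z2; have [_ /(_ gz)[-> h]] := segA _ _ _ G1 z1.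
  by exists e => //; rewrite s2 finset.in_setI h !inE eqxx.
- by case: (EF x2 y2 x1 y1 z).
- by case: gF => -[_ + _ _] _ _; apply; eassumption.
- have [gz s2] := segef _ _ _ G2 z2; have [_ /(_ gz)[-> h]] := segB _ _ _ G1 z1.
  by exists f => //; rewrite s2 finset.in_setI h !inE eqxx orbT.
- have [gz s1] := segef _ _ _ G1 z1; have [_ /(_ gz)[-> h]] := segA _ _ _ G2 z2.
  by exists e => //; rewrite s1 finset.in_setI h !inE eqxx.
- have [gz s1] := segef _ _ _ G1 z1; have [_ /(_ gz)[-> h]] := segB _ _ _ G2 z2.
  by exists f => //; rewrite s1 finset.in_setI h !inE eqxx orbT.
- have [_ s1] := segef _ _ _ G1 z1; have [_ s2] := segef _ _ _ G2 z2.
  by rewrite s1 s2 eqxx in ne.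
Qed.

Lemma join_connect : {in A :|: B &, forall x y, connect G x y}.
Proof.
have toe x : x \in A :|: B -> connect G x e.
  rewrite inE => /orP[xA|xB].
    have : connect E x e by case: gE => -[_ _ + _] _ _; apply.
    by apply: connect_sub => u v Euv; apply: connect1; rewrite /G /join Euv.
  have : connect F x f by case: gF => -[_ _ + _] _ _; apply.
  move=> xf; apply: (@connect_trans _ _ f); last first.
    by apply: connect1; rewrite /G /join !eqxx !orbT.
  by move: xf; apply: connect_sub => u v Fuv; apply: connect1; rewrite /G /join Fuv orbT.
move=> x y /toe xe /toe ye; apply: connect_trans xe _.
by rewrite (sym_connect_sym Gsym).
Qed.

(** The only edge leaving [A] is [ef], and it arrives at [f]. *)
Let stayA x (c : seq S) : x \in A -> f \notin c -> path G x c -> all [in A] (x :: c).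
Proof.
elim: c x => [|y c IH] x xA /=; first by rewrite xA.
rewrite inE negb_or => /andP[fy fc] /andP[/(G_A xA) xy pc].
by case: xy fy => [yA _|[_ ->]]; [rewrite xA /=; exact: IH|rewrite eqxx].
Qed.

Let stayB x (c : seq S) : x \in B -> e \notin c -> path G x c -> all [in B] (x :: c).
Proof.
elim: c x => [|y c IH] x xB /=; first by rewrite xB.
rewrite inE negb_or => /andP[fy fc] /andP[/(G_B xB) xy pc].
by case: xy fy => [yB _|[_ ->]]; [rewrite xB /=; exact: IH|rewrite eqxx].
Qed.

Let stayA' x (c : seq S) : x \in A -> e \notin x :: c -> path G x c -> all [in A] (x :: c).
Proof.
elim: c x => [|y c IH] x xA /=; first by rewrite xA.
rewrite inE negb_or => /andP[ex ec] /andP[/(G_A xA) xy pc].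
by case: xy ex => [yA _|[-> _]]; [rewrite xA /=; exact: IH|rewrite eqxx].
Qed.

(** A cycle that misses [e] or [f] stays in one part, hence in one tree. One through both must use
    [ef] in both directions, so it has length 2. *)
Lemma join_acyclic : acyclic G.
Proof.
have cycA (c : seq S) : uniq c -> all [in A] c -> cycle G c -> (size c <= 2)%N.
  move=> uc cA cG; case: gE => -[_ _ _ acE] _ _; apply: acE => //.
  by apply: sub_in_cycle cA cG => x y xA yA; apply: G_AA.
have cycB (c : seq S) : uniq c -> all [in B] c -> cycle G c -> (size c <= 2)%N.
  move=> uc cB cG; case: gF => -[_ _ _ acF] _ _; apply: acF => //.
  by apply: sub_in_cycle cB cG => x y xA yA; apply: G_BB.
case=> [//|x c] uc Gc.
have [exc|exc] := boolP (e \in x :: c); last first.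
  have pc := Gc; rewrite /= in pc.
  have erc : e \notin rcons c x by rewrite mem_rcons.
  have exrc : e \notin x :: rcons c x.
    by rewrite inE negb_or erc andbT; move: exc; rewrite inE negb_or => /andP[].
  have [xA|xB] : x \in A \/ x \in B.
  - move: pc; rewrite headI /= => /andP[/or4P[/EA|/FB|/andP[/eqP-> _]|/andP[/eqP-> _]]]; by [left|right].
  - apply: cycA => //; have := stayA' xA exrc pc.
    by rewrite /= all_rcons => /and3P[-> _ ->].
  - apply: cycB => //; have := stayB xB erc pc.
    by rewrite /= all_rcons => /and3P[-> _ ->].
have [i p cp] := rot_to exc.
rewrite -(size_rot i) cp; move: uc Gc; rewrite -(rot_uniq i) -(rot_cycle i) cp.
clear i exc cp x c; rename p into c => /= /andP[ec uc] Gc.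
have [fc|fc] := boolP (f \in c); last first.
  apply: (cycA (e :: c)) => /=; rewrite ?ec//.
  have : f \notin rcons c e by rewrite mem_rcons inE eq_sym (negPf nef).
  by move=> /(stayA eA) /(_ Gc) /=; rewrite all_rcons => /and3P[-> _ ->].
case/splitPr: fc ec uc Gc => c1 c2.
rewrite mem_cat inE !negb_or => /and3P[ec1 _ ec2].
rewrite cat_uniq /= negb_or => /and4P[uc1 /andP[fc1 _] fc2 uc2].
rewrite rcons_cat cat_path /= => /and3P[pc1 lc1 pc2].
have c1A : all [in A] (e :: c1) by exact: stayA.
(* The vertex before [f] must be [e], and [e] does not recur, so [c1] is empty; the same argument
   empties [c2]. *)
have {lc1} l1 : last e c1 = e.
  have lA : last e c1 \in A by have := allP c1A _ (mem_last e c1).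
  by case: (G_A lA lc1) => [fA|[]//]; case: (AB fA).
case: c1 l1 ec1 {fc1 uc1 pc1 c1A} => [_ _|x c1 /= l1]; last first.
  by rewrite -l1 mem_last.
move: pc2; rewrite rcons_path => /andP[pc2 lc2].
have c2B : all [in B] (f :: c2) by exact: stayB.
have lB : last f c2 \in B by have := allP c2B _ (mem_last f c2).
case: (G_B lB lc2) => [eB|[l2 _]]; first by case: (AB eA).
by case: c2 l2 fc2 {ec2 uc2 pc2 lc2 c2B lB} => [//|x c2 /= l2]; rewrite -l2 mem_last.
Qed.

Lemma join_nonobtuse :
  {in A, forall x, 0 <= dot (val f - val e) (val x - val e)} ->
  {in B, forall x, 0 <= dot (val e - val f) (val x - val f)} -> nonobtuse G.
Proof.
move=> hA hB p q r; case: gE => _ noE _; case: gF => _ noF _.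
have noA q' r' : p \in A -> G p q' -> G p r' -> 0 <= dot (val q' - val p) (val r' - val p).
  move=> pA Gq Gr; have [q'A|[pe qf]] := G_A pA Gq; have [r'A|[pe' rf]] := G_A pA Gr.
  - by apply: noE; exact: G_AA.
  - by rewrite pe' rf dotC hA.
  - by rewrite pe qf hA.
  - by rewrite pe qf rf dot_ge0.
have noB q' r' : p \in B -> G p q' -> G p r' -> 0 <= dot (val q' - val p) (val r' - val p).
  move=> pA Gq Gr; have [q'A|[pe qf]] := G_B pA Gq; have [r'A|[pe' rf]] := G_B pA Gr.
  - by apply: noF; exact: G_BB.
  - by rewrite pe' rf dotC hB.
  - by rewrite pe qf hB.
  - by rewrite pe qf rf dot_ge0.
move=> Gq Gr; have := Gq.
move=> /or4P[/EA|/FB|/andP[/eqP pe _]|/andP[/eqP pf _]].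
- by move/noA; apply.
- by move/noB; apply.
- by apply: noA => //; rewrite pe.
- by apply: noB => //; rewrite pf.
Qed.

Lemma join_degree_left p : p \in A -> (degree G p <= degree E p + (p == e))%N.
Proof.
move=> pA; rewrite /degree; case: eqP => [pe|pe].
  apply: leq_trans (_ : #|f |: [set q | E p q]| <= _)%N.
    apply/subset_leq_card/fintype.subsetP => q; rewrite !inE => Gq.
    by have [qA|[_ ->]] := G_A pA Gq; rewrite ?eqxx// (G_AA pA qA Gq) orbT.
  by rewrite cardsU1 addnC leq_add2l; case: (_ \notin _).
rewrite addn0; apply/subset_leq_card/fintype.subsetP => q; rewrite !inE => Gq.
by have [qA|[]//] := G_A pA Gq; rewrite (G_AA pA qA Gq).
Qed.

Lemma join_degree_right p : p \in B -> (degree G p <= degree F p + (p == f))%N.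
Proof.
move=> pA; rewrite /degree; case: eqP => [pe|pe].
  apply: leq_trans (_ : #|e |: [set q | F p q]| <= _)%N.
    apply/subset_leq_card/fintype.subsetP => q; rewrite !inE => Gq.
    by have [qA|[_ ->]] := G_B pA Gq; rewrite ?eqxx// (G_BB pA qA Gq) orbT.
  by rewrite cardsU1 addnC leq_add2l; case: (_ \notin _).
rewrite addn0; apply/subset_leq_card/fintype.subsetP => q; rewrite !inE => Gq.
by have [qA|[]//] := G_B pA Gq; rewrite (G_BB pA qA Gq).
Qed.

(** The degrees at [e] and [f] are at most 2 beforehand to leave room for the new edge. *)
Lemma join_good :
  {in A, forall x, 0 <= dot (val f - val e) (val x - val e)} ->
  {in B, forall x, 0 <= dot (val e - val f) (val x - val f)} ->
  (degree E e <= 2)%N -> (degree F f <= 2)%N -> good G (A :|: B).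
Proof.
move=> hA hB dE dF; have GAB x y : G x y -> x \in A :|: B.
  by rewrite inE => /or4P[/EA->|/FB->|/andP[/eqP-> _]|/andP[/eqP-> _]]; rewrite ?eA ?fB ?orbT.
split; [split; [split=> // |exact: join_plane|exact: join_connect|exact: join_acyclic]|exact: join_nonobtuse|].
move=> p; case: gE => _ _ dE3; case: gF => _ _ dF3.
have [/join_degree_left h|pA] := boolP (p \in A).
  by apply: leq_trans h _; case: eqP => [->|_]; rewrite ?addn0 ?addn1.
have [/join_degree_right h|pB] := boolP (p \in B).
  by apply: leq_trans h _; case: eqP => [->|_]; rewrite ?addn0 ?addn1.
rewrite leqW// leqW// leqW// leqn0 cards_eq0; apply/eqP/setP => x; rewrite !inE.
by apply/negP => /GAB; rewrite inE (negPf pA) (negPf pB).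
Qed.

End Join.

(** * Splitting a point set along an edge *)

Hypothesis gp : general_position S.

Lemma cross_neq0 x y p : x != y -> p != x -> p != y ->
  cross (val y - val x) (val p - val x) != 0.
Proof.
move=> xy px py; apply/eqP => c0.
apply: (gp (p := val x) (q := val y) (r := val p));
  rewrite ?(inj_eq val_inj) ?valP// 1?eq_sym//; try exact: valP.
(* The coefficients form a normal vector of the line [xy]. *)
exists (- ((val y).2 - (val x).2)), ((val y).1 - (val x).1).
exists (- ((val y).2 - (val x).2) * (val x).1 + ((val y).1 - (val x).1) * (val x).2).
split; last first.
  by split=> //; move: c0; rewrite crossBE; lra.
apply: contra xy => /eqP[/= h1 h2]; apply/eqP/val_inj.
rewrite (surjective_pairing (\val x)) (surjective_pairing (\val y)).
by congr pair; lra.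
Qed.

(* The sign of [s] chooses which side of the line [ef] is positive; [half A s e f]
   is the part of [A] given to [e], and [half A s f e] the part given to [f]. *)
Definition side s e f x := s * cross (val f - val e) (val x - val e).
Definition half A s e f : {set S} := e |: [set x in A | 0 < side s e f x].
(* Equivalently, [A] lies in a closed right angle at [a]. *)
Definition sharp A a :=
  {in A &, forall x y, 0 <= dot (val x - val a) (val y - val a)}.
(** Together with the side condition this confines the half of [e] to a quadrant at [e] with [ef] on
    its boundary. *)
Definition ahead A s e f :=
  {in A, forall x, 0 < side s e f x -> 0 <= dot (val f - val e) (val x - val e)}.

Lemma sideC s e f x : side s f e x = - side s e f x.
Proof. by rewrite /side !crossBE; ring. Qed.

Lemma side_left s e f : side s e f e = 0.
Proof. by rewrite /side !crossBE; ring. Qed.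

Lemma side_right s e f : side s e f f = 0.
Proof. by rewrite /side !crossBE; ring. Qed.

Lemma half_sub A s e f : e \in A -> half A s e f \subset A.
Proof. by move=> eA; apply/fintype.subsetP => x; rewrite !inE => /orP[/eqP->//|/andP[]]. Qed.

Lemma half_notin A s e f : e != f -> f \notin half A s e f.
Proof. by move=> ef; rewrite !inE side_right ltxx andbF orbF eq_sym. Qed.

Lemma card_half A s e f : e != f -> e \in A -> f \in A ->
  (#|half A s e f| < #|A|)%N.
Proof.
move=> ef eA fA; apply/proper_card/properP; split; first exact: half_sub.
by exists f => //; exact: half_notin.
Qed.

Lemma sharp_sub A B a : B \subset A -> sharp A a -> sharp B a.
Proof. by move=> /fintype.subsetP BA h x y /BA xA /BA; exact: h. Qed.

Lemma sharp_half A s e f : ahead A s e f -> sharp (half A s e f) e.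
Proof.
move=> h x y; rewrite !inE => /orP[/eqP-> _|/andP[xA sx]].
  by rewrite subrr /dot /= !mul0r addr0.
move=> /orP[/eqP->|/andP[yA sy]]; first by rewrite subrr /dot /= !mulr0 addr0.
apply: (@dot_same_side _ (val f - val e)); [exact: h|exact: h|].
have := mulr_gt0 sx sy; rewrite /side => ss.
(* [s] may be negative, but it enters the product of the two sides as a square. *)
have s2 : 0 < s ^+ 2 by rewrite exprn_even_gt0//=; apply: contraTneq sx => s0; rewrite /side s0 mul0r ltxx.
by rewrite -(pmulr_rgt0 _ s2); apply: lt_le_trans ss _; rewrite le_eqVlt; apply/orP; left; apply/eqP; ring.
Qed.

(** By general position only [e] and [f] lie on the line [ef], so the two halves cover [A]. *)
Lemma split_good A s e f E F : s != 0 -> e != f -> e \in A -> f \in A ->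
  ahead A s e f -> ahead A s f e ->
  good E (half A s e f) -> good F (half A s f e) ->
  (degree E e <= 2)%N -> (degree F f <= 2)%N ->
  exists G, [/\ good G A,
    {in half A s e f, forall p, (degree G p <= degree E p + (p == e))%N} &
    {in half A s f e, forall p, (degree G p <= degree F p + (p == f))%N}].
Proof.
move=> s0 ef eA fA he hf gE gF dE dF.
pose g z := s * cross (val f - val e) (z - val e).
have ga u v t : g ((1 - t) *: u + t *: v) = (1 - t) * g u + t * g v.
  by rewrite /g !crossBE /= /GRing.scale /=; ring.
have ge : g (val e) = 0 by exact: side_left.
have gf : g (val f) = 0 by exact: side_right.
have gA : {in half A s e f, forall x, x != e -> 0 < g (val x)}.
  by move=> x; rewrite !inE => /orP[->//|/andP[]].
have gB : {in half A s f e, forall x, x != f -> g (val x) < 0}.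
  by move=> x; rewrite !inE sideC oppr_gt0 => /orP[->//|/andP[]].
have eh : e \in half A s e f by rewrite !inE eqxx.
have fh : f \in half A s f e by rewrite !inE eqxx.
have AE : half A s e f :|: half A s f e = A.
  apply/setP => x; rewrite !inE [side s f e x]sideC oppr_gt0.
  have [->|xe] := eqVneq x e; first by rewrite eA.
  have [->|xf] := eqVneq x f; first by rewrite fA orbT.
  have : side s e f x != 0 by rewrite mulf_neq0// cross_neq0.
  by rewrite neq_lt => /orP[] ->; case: (x \in A); rewrite ?orbT.
exists (join E F e f); split.
- rewrite -AE; apply: (join_good ga ge gf eh fh ef gA gB gE gF) => //.
    move=> x; rewrite !inE => /orP[/eqP->|/andP[xA]]; last exact: he.
    by rewrite subrr /dot /= !mulr0 addr0.
  move=> x; rewrite !inE => /orP[/eqP->|/andP[xA]]; last exact: hf.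
  by rewrite subrr /dot /= !mulr0 addr0.
- exact: (join_degree_left ge gf fh ef gA gB gE gF).
- exact: (join_degree_right ge gf eh ef gA gB gE gF).
Qed.


Definition dist2 x y := dot (val y - val x) (val y - val x).

Lemma dist2C x y : dist2 x y = dist2 y x.
Proof. by rewrite /dist2 /dot /=; ring. Qed.

Lemma dist2_gt0 x y : (0 < dist2 x y) = (x != y).
Proof. by rewrite dot_gt0 subr_eq0 eq_sym (inj_eq val_inj). Qed.

(** Used to see that the angles towards [x] at the two ends of [py] are not both obtuse. *)
Lemma dot_sum x y p :
  dot (val x - val p) (val y - val p) + dot (val x - val y) (val p - val y) = dist2 p y.
Proof. by rewrite /dist2 !dotBE; ring. Qed.

Lemma farthest (P : pred (S * S)) u0 : P u0 ->
  exists2 u, P u & forall v, P v -> dist2 v.1 v.2 <= dist2 u.1 u.2.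
Proof.
move=> P0; case: (Order.TotalTheory.arg_maxP (fun u => dist2 u.1 u.2) P0) => u Pu um.
by exists u => // v Pv; exact: um.
Qed.

Lemma diameter_ahead A c d : {in A &, forall x y, dist2 x y <= dist2 c d} ->
  c \in A -> d \in A -> {in A, forall x, 0 <= dot (val d - val c) (val x - val c)}.
Proof.
move=> h cA dA x xA; apply: dot_ge0_longest; change (dist2 d x <= dist2 d c).
by rewrite [dist2 d c]dist2C; exact: h.
Qed.

(** * Trees rooted at sharp points *)

Definition rooted A a := a \in A -> sharp A a ->
  exists2 E, good E A & (degree E a <= 1)%N.

Definition rooted2 A a b := a \in A -> b \in A -> a != b ->
  sharp A a -> sharp A b ->
  exists E, [/\ good E A, (degree E a <= 1)%N & (degree E b <= 2)%N].

Lemma half1 A s e f : {in A, forall x, side s e f x <= 0} -> half A s e f = [set e].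
Proof.
move=> h; apply/setP => x; rewrite !inE; case: (boolP (x \in A)) => /= [/h|_].
  by rewrite leNgt => /negPf->; rewrite orbF.
by rewrite orbF.
Qed.

Lemma degree0 p : degree [rel _ _ : S | false] p = 0%N.
Proof. by apply/eqP; rewrite cards_eq0; apply/eqP/setP => x; rewrite !inE. Qed.

Lemma rooted_step A a :
  (forall B x, (#|B| < #|A|)%N -> rooted B x) ->
  (forall B x y, (#|B| < #|A|)%N -> rooted2 B x y) ->
  rooted A a.
Proof.
move=> IH1 IH2 aA shA.
have [/eqP A1|] := eqVneq (A :\ a) finset.set0.
  have -> : A = [set a] by apply/eqP; rewrite finset.eqEsubset finset.sub1set aA -finset.setD_eq0 A1.
  by exists [rel _ _ | false]; [exact: good_single|rewrite degree0].
move=> /set0Pn[x]; rewrite !inE => /andP[xa xA].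
pose P (u : S * S) := (u.1 \in A :\ a) && (u.2 \in A :\ a).
have P0 : P (x, x) by rewrite /P /= !inE xa xA.
have [[c d] /= /andP[/=]] := farthest P0.
rewrite !inE => /andP[ca cA] /andP[da dA] diam.
have {diam} diam y z : y \in A -> z \in A -> y != a -> z != a -> dist2 y z <= dist2 c d.
  by move=> yA zA ya za; apply: (diam (y, z)); rewrite /P /= !inE ya yA za zA.
(* The maximum runs over pairs that may coincide; if it is attained at [c = d], then [A] consists of
   [a] and [c]. *)
have [cd|cd] := eqVneq c d.
  have A2 y : y \in A -> y != a -> y = c.
    move=> yA ya; apply/eqP; apply: contraT; rewrite -dist2_gt0 => /lt_le_trans H.
    by have := H _ (diam _ _ yA cA ya ca); rewrite cd /dist2 subrr /dot /= mul0r addr0 ltxx.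
  have s0 t : {in A, forall y, side t a c y = 0}.
    move=> y yA; have [->|ya] := eqVneq y a; first exact: side_left.
    by rewrite (A2 _ yA ya) side_right.
  have ac : a != c by rewrite eq_sym.
  have h1 : half A 1 a c = [set a] by apply: half1 => y yA; rewrite s0.
  have h2 : half A 1 c a = [set c] by apply: half1 => y yA; rewrite sideC s0 ?oppr0.
  have [||||||||||G [gG dG _]] := @split_good A 1 a c [rel _ _ | false] [rel _ _ | false].
  - exact: oner_neq0.
  - exact: ac.
  - exact: aA.
  - exact: cA.
  - by move=> y yA; rewrite s0 ?ltxx.
  - by move=> y yA; rewrite sideC s0 ?oppr0 ?ltxx.
  - by rewrite h1; exact: good_single.
  - by rewrite h2; exact: good_single.
  - by rewrite degree0.
  - by rewrite degree0.
  by exists G => //; have := dG a; rewrite h1 inE eqxx degree0; apply.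
(* By [dot_sum] the angle towards [a] is not obtuse at one end of the diameter; call that end
   [d]. *)
wlog acute : c d ca cA da dA cd diam / 0 <= dot (val a - val d) (val c - val d).
  move=> H; have [/H|] := leP 0 (dot (val a - val d) (val c - val d)); first exact.
  move=> neg; apply: (H d c) => //; first by rewrite eq_sym.
    by move=> y z yA zA ya za; rewrite [dist2 d c]dist2C; exact: diam.
  have := dot_sum a d c; have := dist2_gt0 c d; rewrite cd dotC.
  by move: neg; rewrite [dot (val d - val c) _]dotC; lra.
(* This choice makes [side s d c a] a square, so that [a] falls into the half of [d]. *)
pose s := cross (val c - val d) (val a - val d).
have dc : d != c by rewrite eq_sym.
have s0 : s != 0 by rewrite cross_neq0// eq_sym.
have sa : 0 < side s d c a by rewrite /side -/s -expr2 exprn_even_gt0.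
have hd : ahead A s d c.
  move=> y yA _; have [->|ya] := eqVneq y a; first by rewrite dotC.
  apply: dot_ge0_longest; change (dist2 c y <= dist2 c d); exact: diam.
have hc : ahead A s c d.
  move=> y yA; have [->|ya _] := eqVneq y a.
    by rewrite sideC oppr_gt0 => /lt_trans /(_ sa); rewrite ltxx.
  apply: dot_ge0_longest; change (dist2 d y <= dist2 d c).
  by rewrite [dist2 d c]dist2C; exact: diam.
have [||E gE dE] := IH1 (half A s c d) c (card_half s cd cA dA).
- by rewrite !inE eqxx.
- exact: sharp_half.
(* Here [a] and [d] are both sharp, so claim (2) gives [a] degree at most 1 and leaves room at [d]
   for the edge to [c]. *)
have [||||| F [gF aF dF]] := IH2 (half A s d c) a d (card_half s dc dA cA).
- by rewrite !inE aA sa orbT.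
- by rewrite !inE eqxx.
- by rewrite eq_sym.
- exact: sharp_sub (half_sub _ _ dA) shA.
- exact: sharp_half.
have [||||||||||G [gG dG _]] := @split_good A s d c F E => //.
  exact: leqW.
exists G => //; have := dG a; rewrite !inE aA sa orbT => /(_ isT).
by rewrite eq_sym (negPf da) addn0 => /leq_trans; apply.
Qed.

(** * The longest segment across the line [ab] *)

Lemma obtuse_between (v w x y : R * R) : cross w v != 0 ->
  0 < cross w v * cross w x -> 0 < cross w v * cross w y ->
  0 < cross w v * cross v x -> cross w v * cross v y < 0 ->
  dot v x < 0 -> dot v y < 0 -> False.
Proof.
set k := cross w v => k0 wx wy vx vy dx dy.
(* A positive combination of [x] and [y] parallel to [v]. Obtuseness makes it point against [v], yet
   it lies on the same side of [w] as [v]. *)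
pose z := (k * cross v x) *: y - (k * cross v y) *: x.
have dz : dot v z = k * cross v x * dot v y - k * cross v y * dot v x.
  by rewrite /z /cross /dot /= /GRing.scale /=; ring.
have wz : k * cross w z = k * cross v x * (k * cross w y) - k * cross v y * (k * cross w x).
  by rewrite /z /cross /= /GRing.scale /=; ring.
have vz : cross v z = 0 by rewrite /z /cross /= /GRing.scale /=; ring.
have : 0 < k * cross w z by rewrite wz; nra.
have dz0 : dot v z < 0 by rewrite dz; nra.
have k2 : 0 < k * k by rewrite -expr2 exprn_even_gt0.
have e := dot_cramer v w z; move: e; rewrite vz mul0r subr0 -/k => e kwz.
have : k * k * dot v z = k * cross w z * dot v v by rewrite -mulrA e mulrA.
have := dot_ge0 v; nra.
Qed.

(* [x] lies on the side of [q] of the line [ab], on the side of [a] of the line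
   [pq], and not beyond [a]. *)
Lemma ahead_corner (v w p a x : R * R) : cross w v != 0 -> w != 0 ->
  0 <= dot v (a - p) -> 0 <= dot w (x - a) ->
  0 <= cross w v * cross w (x - a) ->
  0 <= cross w v * cross w (x - p) ->
  0 <= cross w v * cross v (x - p) -> 0 <= dot v (x - p).
Proof.
(* If [w] is not obtuse to [v], then neither is [x - a], and [a - p] adds to it. Otherwise both
   terms of Cramer's rule for [x - p] are nonnegative. *)
set k := cross w v => k0 w0 va wx cx cp vp; have [vw|vw] := leP 0 (dot v w).
  have : 0 <= dot w w * dot v (x - a).
    by rewrite dotM [dot w v]dotC addr_ge0// mulr_ge0.
  rewrite pmulr_rge0 ?dot_gt0// => h.
  have -> : dot v (x - p) = dot v (x - a) + dot v (a - p) by rewrite /dot /=; ring.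
  exact: addr_ge0.
have k2 : 0 < k * k by rewrite -expr2 exprn_even_gt0.
rewrite -(pmulr_rge0 _ k2) -mulrA dot_cramer mulrBr !mulrA subr_ge0.
by apply: (@le_trans _ _ 0); [rewrite mulr_ge0_le0// ltW|rewrite mulr_ge0// dot_ge0].
Qed.

Definition opposite a b x y :=
  cross (val b - val a) (val x - val a) * cross (val b - val a) (val y - val a) < 0.

Definition farthest_opposite A a b p q := [/\ p \in A, q \in A, opposite a b p q &
  {in A &, forall x y, opposite a b x y -> dist2 x y <= dist2 p q}].

Lemma oppositeC a b x y : opposite a b x y = opposite b a y x.
Proof. by rewrite /opposite !crossBE; congr (_ < 0); ring. Qed.

Lemma farthest_oppositeC A a b p q :
  farthest_opposite A a b p q -> farthest_opposite A b a q p.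
Proof.
case=> pA qA o h; split=> //; first by rewrite -oppositeC.
by move=> x y xA yA oxy; rewrite dist2C [dist2 q p]dist2C h// oppositeC.
Qed.

Lemma farthest_opposite_swap A a b p q :
  farthest_opposite A a b p q -> farthest_opposite A a b q p.
Proof.
case=> pA qA o h; split=> //; first by rewrite /opposite mulrC.
by move=> x y xA yA oxy; rewrite [dist2 q p]dist2C h.
Qed.

Section Opposite.
Variables (A : {set S}) (a b p q : S).
Hypotheses (bA : b \in A) (ab : a != b) (shA : sharp A a).
Hypothesis pq : farthest_opposite A a b p q.
Let w := val b - val a.
Let v := val q - val p.
Let k := cross w v.

(** [k] is a difference of two numbers of opposite signs, so it has the sign of the first:
    multiplying by [k] makes the side of [q] positive. *)
Lemma opposite_sides :
  0 < k * cross w (val q - val a) /\ k * cross w (val p - val a) < 0.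
Proof.
case: pq => _ _; rewrite /opposite -/w => o _.
have -> : k = cross w (val q - val a) - cross w (val p - val a).
  by rewrite /k /cross /=; ring.
by split; nra.
Qed.

Lemma opposite_neq : [/\ p != q, a != p & a != q].
Proof.
have [kq kp] := opposite_sides.
split.
- by apply: contraTneq kp => ->; rewrite -leNgt ltW.
- apply: contraTneq kp => <-; rewrite subrr; have -> : cross w 0 = 0 by rewrite /cross /= !mulr0 subr0.
  by rewrite mulr0 ltxx.
- apply: contraTneq kq => <-; rewrite subrr; have -> : cross w 0 = 0 by rewrite /cross /= !mulr0 subr0.
  by rewrite mulr0 ltxx.
Qed.

(** As [a] is sharp, [p] and [q] are not behind [a] along [w], and they lie on different sides of
    [w]. So the angle [paq] contains [w] and is less than [pi], which fixes the side of [a]. *)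
Lemma opposite_side : 0 < side k p q a.
Proof.
have [kq kp] := opposite_sides; have [npq nap naq] := opposite_neq.
have k0 : k != 0 by apply: contraTneq kq => ->; rewrite mul0r ltxx.
have s0 : side k p q a != 0 by rewrite mulf_neq0// cross_neq0.
rewrite lt_def s0 /=; have w0 : 0 < dot w w.
  by rewrite dot_gt0 subr_eq0 eq_sym (inj_eq val_inj).
rewrite -(pmulr_rge0 _ w0).
case: pq => pA qA _ _.
have -> : dot w w * side k p q a =
    dot w (val p - val a) * (k * cross w (val q - val a)) -
    k * cross w (val p - val a) * dot w (val q - val a).
  rewrite /side; have -> : cross (val q - val p) (val a - val p) =
      cross (val p - val a) (val q - val a) by rewrite !crossBE; ring.
  by rewrite mulrCA crossM; ring.
rewrite subr_ge0; apply: (@le_trans _ _ 0).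
  by apply: mulr_le0_ge0; [exact: ltW|exact: shA].
by apply: mulr_ge0; [exact: shA|exact: ltW].
Qed.

End Opposite.

(** A point [x] on the side of [a] of the line [pq] is either across [ab] from [q], and then
    maximality of [pq] applies, or with [q], and then [ahead_corner] applies. *)
Lemma opposite_ahead A a b p q : a \in A -> b \in A -> a != b ->
  sharp A a -> sharp A b -> farthest_opposite A a b p q ->
  0 <= dot (val q - val p) (val a - val p) ->
  ahead A (cross (val b - val a) (val q - val p)) p q.
Proof.
move=> aA bA ab sha shb pq apq; set k := cross _ _.
have [kq kp] := opposite_sides pq; rewrite -/k in kq kp.
have ba : b != a by rewrite eq_sym.
have := opposite_side aA ba shb (farthest_oppositeC pq).
have -> : cross (val a - val b) (val p - val q) = k by rewrite /k /cross /=; ring.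
rewrite sideC => kb; have k0 : k != 0 by apply: contraTneq kq => ->; rewrite mul0r ltxx.
case: pq => pA qA o far x xA kx.
have [->//|xa] := eqVneq x a.
have xb : x != b by apply: contraTneq kx => ->; rewrite -leNgt -oppr_ge0 ltW.
have : k * cross (val b - val a) (val x - val a) != 0 by rewrite mulf_neq0// cross_neq0.
rewrite neq_lt => /orP[kx0|kx0].
  apply: dot_ge0_longest; change (dist2 q x <= dist2 q p).
  rewrite dist2C [dist2 q p]dist2C far// /opposite.
  have k2 : 0 < k * k by rewrite -expr2 exprn_even_gt0.
  by rewrite -(pmulr_rlt0 _ k2) mulrACA nmulr_rlt0.
apply: (@ahead_corner _ (val b - val a) _ (val a)) => //; rewrite -/k.
- by rewrite subr_eq0 (inj_eq val_inj).
- exact: sha.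
- exact: ltW.
- rewrite (_ : cross _ _ = cross (val b - val a) (val x - val a) - cross (val b - val a) (val p - val a)); last by rewrite /cross /=; ring.
  by rewrite mulrBr subr_ge0 ltW// (lt_trans kp).
- exact: ltW.
Qed.

Lemma crossN_opp a b p q :
  cross (val a - val b) (val p - val q) = cross (val b - val a) (val q - val p).
Proof. by rewrite /cross /=; ring. Qed.

Lemma not_both_obtuse A a b p q : a \in A -> b \in A -> a != b ->
  sharp A a -> sharp A b -> farthest_opposite A a b p q ->
  dot (val q - val p) (val a - val p) < 0 ->
  dot (val q - val p) (val b - val p) < 0 -> False.
Proof.
move=> aA bA ab sha shb pq; have [kq kp] := opposite_sides pq.
have ba : b != a by rewrite eq_sym.
have sa := opposite_side bA ab sha pq.
have := opposite_side aA ba shb (farthest_oppositeC pq).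
rewrite crossN_opp sideC oppr_gt0 => sb.
apply: (@obtuse_between _ (val b - val a)) => //.
- by apply: contraTneq kq => ->; rewrite mul0r ltxx.
- move: kp; rewrite -oppr_gt0 -mulrN; congr (_ < _ * _).
  by rewrite /cross /=; ring.
- move: kp; rewrite -oppr_gt0 -mulrN; congr (_ < _ * _).
  by rewrite /cross /=; ring.
Qed.

Lemma rooted2_step A a b :
  (forall B x, (#|B| < #|A|)%N -> rooted B x) ->
  (forall B x y, (#|B| < #|A|)%N -> rooted2 B x y) ->
  rooted2 A a b.
Proof.
move=> IH1 IH2 aA bA ab sha shb.
have ba : b != a by rewrite eq_sym.
have [|none] := boolP [exists x in A, exists y in A, opposite a b x y]; last first.
  (* The sign [s] leaves [a] alone in its half, so that [a] becomes a leaf attached to [b]. *)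
  have [s s0 hs] : exists2 s, s != 0 & {in A, forall x, side s a b x <= 0}.
    have [/existsP[x /andP[xA x0]]|] := boolP [exists x in A, 0 < side 1 a b x].
      exists (-1); first by rewrite oppr_eq0 oner_eq0.
      move=> y yA; move: none; rewrite negb_exists => /forallP/(_ x).
      rewrite xA /= negb_exists => /forallP/(_ y); rewrite yA /= /opposite -leNgt.
      by move: x0; rewrite /side mul1r mulN1r oppr_le0 => /pmulr_rge0 ->.
    rewrite negb_exists => /forallP h; exists 1; first exact: oner_neq0.
    by move=> x xA; have := h x; rewrite xA /= leNgt.
  have hab : ahead A s a b by move=> x /hs; rewrite leNgt => /negPf->.
  have hba : ahead A s b a by move=> x xA _; exact: shb.
  have [||E gE dE] := IH1 (half A s b a) b (card_half s ba bA aA).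
  - by rewrite !inE eqxx.
  - exact: sharp_half.
  have [||||||||||G [gG da db]] := @split_good A s a b [rel _ _ | false] E => //.
  - by rewrite (half1 hs); exact: good_single.
  - by rewrite degree0.
  - exact: leqW.
  exists G; split=> //.
    by have := da a; rewrite !inE eqxx degree0; apply.
  by have := db b; rewrite !inE eqxx => /(_ isT) /leq_trans; apply; rewrite addn1.
move=> /existsP[x /andP[xA /existsP[y /andP[yA oxy]]]].
pose P (u : S * S) := [&& u.1 \in A, u.2 \in A & opposite a b u.1 u.2].
have P0 : P (x, y) by rewrite /P /= xA yA.
have [[p q] /= /and3P[/= pA qA opq] far] := farthest P0.
have {far} pq : farthest_opposite A a b p q.
  by split=> // u v uA vA uv; apply: (far (u, v)); rewrite /P /= uA vA.
(* The step with [u] taking the side of [a] and [v] the side of [b]; claim (2) is used on both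
   sides. *)
have matched u v : farthest_opposite A a b u v ->
    0 <= dot (val v - val u) (val a - val u) ->
    0 <= dot (val u - val v) (val b - val v) ->
    exists E, [/\ good E A, (degree E a <= 1)%N & (degree E b <= 2)%N].
  move=> uv au bv; have vu := farthest_oppositeC uv.
  have ha := opposite_ahead aA bA ab sha shb uv au.
  have hb := opposite_ahead bA aA ba shb sha vu bv.
  have sa := opposite_side bA ab sha uv; have sb := opposite_side aA ba shb vu.
  have [nuv nau nav] := opposite_neq uv; have [nvu nbv nbu] := opposite_neq vu.
  have [uA vA _ _] := uv; have [kv _] := opposite_sides uv.
  rewrite crossN_opp in hb sb; set k := cross _ _ in ha hb sa sb kv.
  have k0 : k != 0 by apply: contraTneq kv => ->; rewrite mul0r ltxx.
  have [||||| E [gE aE uE]] := IH2 (half A k u v) a u (card_half k nuv uA vA).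
  - by rewrite !inE aA sa orbT.
  - by rewrite !inE eqxx.
  - exact: nau.
  - exact: sharp_sub (half_sub _ _ uA) sha.
  - exact: sharp_half.
  have [||||| F [gF bF vF]] := IH2 (half A k v u) b v (card_half k nvu vA uA).
  - by rewrite !inE bA sb orbT.
  - by rewrite !inE eqxx.
  - exact: nbv.
  - exact: sharp_sub (half_sub _ _ vA) shb.
  - exact: sharp_half.
  have [G [gG da db]] := split_good k0 nuv uA vA ha hb gE gF uE vF.
  exists G; split=> //.
    by have := da a; rewrite !inE aA sa orbT (negPf nau) addn0 => /(_ isT) /leq_trans; apply.
  have := db b; rewrite !inE bA sb orbT (negPf nbv) addn0 => /(_ isT) /leq_trans; apply.
  exact: leqW.
have qp := farthest_opposite_swap pq.
have obt := not_both_obtuse aA bA ab sha shb pq.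
have obt' := not_both_obtuse aA bA ab sha shb qp.
have [npq _ _] := opposite_neq pq.
have := dist2_gt0 p q; rewrite npq => d0.
have sa := dot_sum a q p; have sb := dot_sum b q p.
(* Of the four angles at [p] and [q] towards [a] and [b], two obtuse ones share neither apex ([obt],
   [obt']) nor target ([sa], [sb]). So one of the two matchings has no obtuse angle. *)
have [ap|ap] := leP 0 (dot (val q - val p) (val a - val p)).
  have [bq|bq] := leP 0 (dot (val p - val q) (val b - val q)); first exact: (matched p q).
  have [aq|aq] := leP 0 (dot (val p - val q) (val a - val q)); last by case: obt'.
  apply: (matched q p) => //; move: sb bq; rewrite dotC [dot (val b - val q) _]dotC; lra.
have [bp|bp] := leP 0 (dot (val q - val p) (val b - val p)); last by case: obt.
apply: (matched q p) => //; move: sa ap; rewrite dotC [dot (val a - val q) _]dotC; lra.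
Qed.

Lemma rooted_all A : (forall a, rooted A a) /\ (forall a b, rooted2 A a b).
Proof.
have [n] := ubnP #|A|; elim: n A => // n IH A; rewrite ltnS => An.
by split=> *; [apply: rooted_step|apply: rooted2_step] => B *;
  apply IH; apply: leq_trans An.
Qed.

Lemma good_exists A : A != finset.set0 -> exists E, good E A.
Proof.
move=> /set0Pn[x xA]; pose P (u : S * S) := (u.1 \in A) && (u.2 \in A).
have P0 : P (x, x) by rewrite /P /= xA.
have [[c d] /= /andP[/= cA dA] diam] := farthest P0.
have {}diam : {in A &, forall y z, dist2 y z <= dist2 c d}.
  by move=> y z yA zA; apply: (diam (y, z)); rewrite /P /= yA zA.
have [cd|cd] := eqVneq c d.
  exists [rel _ _ | false]; rewrite (_ : A = [set c]); first exact: good_single.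
  apply/setP => y; rewrite inE; apply/idP/eqP => [yA|->//].
  apply/eqP; apply: contraT; rewrite -dist2_gt0 => /lt_le_trans /(_ (diam _ _ yA cA)).
  by rewrite cd /dist2 subrr /dot /= mul0r addr0 ltxx.
have dc : d != c by rewrite eq_sym.
have hc : ahead A 1 c d.
  by move=> y yA _; apply: (diameter_ahead diam).
have hd : ahead A 1 d c.
  by move=> y yA _; apply: (@diameter_ahead A) => // u v uA vA; rewrite [dist2 d c]dist2C diam.
have [||E gE dE] := (rooted_all (half A 1 c d)).1 c.
- by rewrite !inE eqxx.
- exact: sharp_half.
have [||F gF dF] := (rooted_all (half A 1 d c)).1 d.
- by rewrite !inE eqxx.
- exact: sharp_half.
have [||||||||||G [gG _ _]] := @split_good A 1 c d E F => //.
- exact: leqW.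
- exact: leqW.
by exists G.
Qed.

End Tree.

(** * Angles and openness *)

Section Angle.
Variable R : realType.
Implicit Types (u v x y : R * R) (t s w : R).

Lemma enorm_gt0 v : v != 0 -> 0 < enorm v.
Proof. by rewrite -dot_gt0 => v0; rewrite sqrtr_gt0. Qed.

Lemma sqr_enorm v : enorm v ^+ 2 = dot v v.
Proof. by rewrite sqr_sqrtr// dot_ge0. Qed.

(** Identifies [ccw_angle] as a polar angle, so that later arguments need only its cosine and
    sine. *)
Lemma ccw_angleP u v : u != 0 -> v != 0 ->
  [/\ 0 <= ccw_angle u v <= 2 * pi,
      dot u v = enorm u * enorm v * cos (ccw_angle u v) &
      cross u v = enorm u * enorm v * sin (ccw_angle u v)].
Proof.
move=> u0 v0; set N := enorm u * enorm v.
have N0 : 0 < N by rewrite mulr_gt0 ?enorm_gt0.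
have NN : dot u v ^+ 2 + cross u v ^+ 2 = N ^+ 2.
  by rewrite exprMn !sqr_enorm dotM !expr2.
have c1 : (dot u v / N) ^+ 2 <= 1.
  by rewrite expr_div_n ler_pdivrMr ?exprn_gt0// mul1r -NN lerDl sqr_ge0.
have cB : -1 <= dot u v / N <= 1 by rewrite -ler_norml -(@expr_le1 _ 2) ?normr_ge0// real_normK// num_real.
rewrite /ccw_angle -/N; have [/andP[a0 api] ca] := acos_def cB.
have sa : sin (acos (dot u v / N)) = `|cross u v| / N.
  rewrite sin_acos//; have -> : 1 - (dot u v / N) ^+ 2 = (`|cross u v| / N) ^+ 2.
    rewrite !expr_div_n real_normK ?num_real// -[X in X - _](@divff _ (N ^+ 2)) ?expf_neq0 ?gt_eqF//.
    by rewrite -mulrBl -{1}NN addrAC subrr add0r.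
  by rewrite sqrtr_sqr ger0_norm// divr_ge0// ltW.
have NK z : N * (z / N) = z by rewrite mulrC divfK// gt_eqF.
have [cr|cr] := leP 0 (cross u v); split => /=.
- by rewrite a0; have := pi_ge0 R; lra.
- by rewrite ca NK.
- by rewrite sa NK ger0_norm.
- by have := pi_ge0 R; lra.
- by rewrite cosB mulr_natl cos2pi sin2pi mul1r mul0r addr0 ca NK.
- by rewrite sinB mulr_natl cos2pi sin2pi mul1r mul0r sub0r sa mulrN NK ltr0_norm// opprK.
Qed.

Lemma ccw_angle_ge u v : u != 0 -> v != 0 -> cross u v < 0 -> 0 <= dot u v ->
  3 * pi / 2 <= ccw_angle u v.
Proof.
move=> u0 v0 cuv duv; have [aB dE sE] := ccw_angleP u0 v0.
set a := ccw_angle u v in aB dE sE *.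
have p0 := pi_gt0 R; have N0 : 0 < enorm u * enorm v by rewrite mulr_gt0 ?enorm_gt0.
rewrite sE pmulr_rlt0// in cuv; rewrite dE pmulr_rge0// in duv.
have pa : pi < a.
  rewrite ltNge; apply/negP => api.
  suff : 0 <= sin a by rewrite leNgt cuv.
  by apply: sin_ge0_pi; lra.
rewrite leNgt; apply/negP => a3.
have : 0 < cos (a - pi) by apply: cos_gt0_pihalf; lra.
by rewrite -[a](subrK pi) cosDpi in duv; lra.
Qed.

(** Both polar angles lie in an interval of length [2 * pi - w], at most [pi / 2], on which the
    cosine decreases. *)
Lemma dot_angles u x y a b w : u != 0 -> x != 0 -> y != 0 ->
  3 * pi / 2 <= w -> w <= a <= 2 * pi -> w <= b <= 2 * pi ->
  dot u x = enorm u * enorm x * cos a -> cross u x = enorm u * enorm x * sin a ->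
  dot u y = enorm u * enorm y * cos b -> cross u y = enorm u * enorm y * sin b ->
  enorm x * enorm y * cos w <= dot x y.
Proof.
move=> u0 x0 y0 w3 wa wb dx cx dy cy.
have ux := enorm_gt0 u0; have nx := enorm_gt0 x0; have ny := enorm_gt0 y0.
have -> : dot x y = enorm x * enorm y * cos (a - b).
  have u2 : enorm u ^+ 2 != 0 by rewrite expf_neq0// gt_eqF.
  apply: (mulfI u2); rewrite {1}sqr_enorm dotM dx cx dy cy cosB; ring.
rewrite ler_pM2l ?mulr_gt0//.
have p0 := pi_gt0 R.
have -> : cos w = cos (2 * pi - w).
  by rewrite cosB mulr_natl cos2pi sin2pi mul1r mul0r addr0.
have -> : cos (a - b) = cos `|a - b|.
  by case: (leP 0 (a - b)) => [/ger0_norm->|/ltr0_norm->]//; rewrite cosN.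
have ab : `|a - b| <= 2 * pi - w by rewrite ler_norml; lra.
rewrite leNgt ltr_cos ?in_itv/=.
- by rewrite -leNgt.
- by apply/andP; split; lra.
- by rewrite normr_ge0/=; apply: le_trans ab _; lra.
Qed.

End Angle.

(** * Openness in terms of dot products *)

Section Openness.
Variables (R : realType) (S : {fset R * R}).
Implicit Types (E : rel S) (p q r x y : S).

Lemma val_sub_neq0 x y : (val x - val y != 0) = (x != y).
Proof. by rewrite subr_eq0 (inj_eq val_inj). Qed.

Lemma is_open_nonobtuse E : general_position S -> irreflexive E -> nonobtuse E ->
  is_open E (3 * pi / 2).
Proof.
move=> gp irr nob; have p0 := pi_gt0 R.
have pi32 : 3 * pi / 2 <= 2 * pi :> R by lra.
apply: le_bigmin => // p _; rewrite /vertex_openness.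
case: leqP => // d2.
have nE x : E p x -> x != p by apply: contraTneq => ->; rewrite irr.
have [q0 pq0] : exists q, E p q.
  have : (0 < degree E p)%N by apply: ltnW.
  by rewrite card_gt0 => /set0Pn[q]; rewrite inE; exists q.
(* The [q] with the largest [lead q] is the counterclockwise-most neighbour, and
   the angle that follows it is the large one. *)
pose lead q := [set s | E p s & 0 <= cross (val s - val p) (val q - val p)].
have [q pq qmax] := arg_maxnP (fun q => #|lead q|) pq0.
have qlead s : E p s -> s != q -> cross (val q - val p) (val s - val p) < 0.
  move=> ps sq; rewrite ltNge; apply/negP => c0.
  have c1 : 0 < cross (val q - val p) (val s - val p).
    by rewrite lt_def c0 andbT; apply: (cross_neq0 gp) => //; [rewrite eq_sym; exact: nE|exact: nE].
  have : (#|lead s| <= #|lead q|)%N := qmax s ps.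
  rewrite leqNgt => /negP; apply; apply: proper_card.
  apply/properP; split.
    (* Within a right angle the order by [cross] is transitive: by [crossM], from [u] before [q] and
       [q] before [s] follows [u] before [s]. *)
    apply/fintype.subsetP => u; rewrite !inE => /andP[pu cu]; rewrite pu /=.
    have v0 : 0 < dot (val q - val p) (val q - val p) by rewrite dot_gt0 val_sub_neq0 nE.
    rewrite -(pmulr_rge0 _ v0) crossM.
    have := nob _ _ _ pq pu; have := nob _ _ _ pq ps => du ds.
    have -> : cross (val q - val p) (val u - val p) = - cross (val u - val p) (val q - val p).
      by rewrite !crossBE; ring.
    by rewrite mulNr opprK addr_ge0// mulr_ge0.
  exists s; rewrite !inE ps /=.
    by rewrite /cross mulrC subrr.
  rewrite -ltNge; suff -> : cross (val s - val p) (val q - val p) = - cross (val q - val p) (val s - val p).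
    by rewrite oppr_lt0.
  by rewrite !crossBE; ring.
have [r0 /andP[pr0 r0q]] : exists r, E p r && (r != q).
  have : (0 < #|[set s | E p s] :\ q|)%N.
    by move: d2; rewrite /degree (cardsD1 q) inE pq.
  by rewrite card_gt0 => /set0Pn[r]; rewrite !inE andbC; exists r.
pose P r := E p r && (r != q).
have P0 : P r0 by rewrite /P pr0.
have [r /andP[pr rq] rmin] := arg_minP (angle_at p q) P0.
apply: (bigmax_sup (q, r)) => /=.
  rewrite /next_edge pq pr eq_sym rq /=; apply/forallP => s; apply/implyP; exact: rmin.
by apply: ccw_angle_ge; rewrite ?val_sub_neq0 ?nE// ?qlead// nob.
Qed.

(** A gap of at least [w] after some edge [pq] would push all edges at [p] into a sector of angle
    [2 * pi - w], against the bound on [dot]. *)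
Lemma vertex_openness_lt E p x y w : irreflexive E -> E p x -> E p y -> x != y ->
  3 * pi / 2 <= w <= 2 * pi ->
  dot (val x - val p) (val y - val p) <
    enorm (val x - val p) * enorm (val y - val p) * cos w ->
  vertex_openness E p < w.
Proof.
move=> irr px py xy wb dxy; have p0 := pi_gt0 R.
have nE z : E p z -> val z - val p != 0.
  by rewrite val_sub_neq0; apply: contraTneq => ->; rewrite irr.
have d2 : (2 <= degree E p)%N.
  rewrite -(_ : #|[set x; y]| = 2)%N; last by rewrite cards2 xy.
  by apply/subset_leq_card/fintype.subsetP => z; rewrite !inE => /orP[]/eqP->.
rewrite /vertex_openness leqNgt d2 /=.
apply/bigmax_ltP; split=> [|[q r] /= /and4P[pq pr _ /forallP nxt]]; first by lra.
rewrite ltNge; apply/negP => wr.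
have polar z : E p z -> exists a, [/\ w <= a <= 2 * pi,
    dot (val q - val p) (val z - val p) = enorm (val q - val p) * enorm (val z - val p) * cos a &
    cross (val q - val p) (val z - val p) = enorm (val q - val p) * enorm (val z - val p) * sin a].
  move=> pz; have [->|zq] := eqVneq z q.
    (* The edge [pq] itself is given the angle [2 * pi] instead of 0, to lie in the same interval as
       the others. *)
    exists (2 * pi); rewrite mulr_natl cos2pi sin2pi mulr0 mulr1 -expr2 sqr_enorm; split=> //.
      by rewrite -mulr_natl; lra.
    by rewrite /cross mulrC subrr.
  have [aB dE sE] := ccw_angleP (nE _ pq) (nE _ pz).
  exists (angle_at p q z); split=> //; have := nxt z; rewrite pz zq /= => rz.
  by rewrite (le_trans wr rz) /=; case/andP: aB.
have [a [aB da ca]] := polar x px; have [b [bB db cb]] := polar y py.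
have w3 : 3 * pi / 2 <= w by lra.
have := dot_angles (nE _ pq) (nE _ px) (nE _ py) w3 aB bB da ca db cb.
by rewrite leNgt dxy.
Qed.

End Openness.

(** * Sharpness of the bound *)

Section Fan.
Variable R : realType.
Implicit Types (h t : R) (n : nat).

(** A point of the parabola [(1 + t ^+ 2, t)], whose tangent at [t = 0] is orthogonal to the
    direction from the origin; [h] bounds [t]. *)
Definition fan_point h n : R * R := (1 + (h / n.+1%:R) ^+ 2, h / n.+1%:R).

Definition fan h n : {fset R * R} :=
  [fset z in (0, 0) :: [seq fan_point h i | i <- iota 0 n]]%fset.

Lemma fan_pointP h n z : 0 < h -> z \in fan h n ->
  z = (0, 0) \/ exists2 t, 0 < t <= h & z = (1 + t ^+ 2, t).
Proof.
move=> h0; rewrite !inE => /orP[/eqP->|/mapP[i _ ->]]; [by left|right].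
exists (h / i.+1%:R) => //; rewrite divr_gt0//=.
by rewrite ler_pdivrMr// ler_peMr ?ler1n// ltW.
Qed.

Lemma origin_fan h n : (0, 0) \in fan h n.
Proof. by rewrite !inE eqxx. Qed.

Lemma card_fan h n : 0 < h -> #|` fan h n|%fset = n.+1.
Proof.
move=> h0; rewrite card_fseq undup_id /= ?size_map ?size_iota//.
apply/andP; split.
  apply/mapP => -[i _ [e _]].
  by move: e; apply/eqP; rewrite lt_eqF// ltr_wpDr ?sqr_ge0.
rewrite map_inj_uniq ?iota_uniq// => i j [_ /(mulfI (lt0r_neq0 h0)) /invr_inj].
by move=> /eqP; rewrite eqr_nat eqSS => /eqP.
Qed.

(** A line through the origin meets the parabola at parameters with product 1, impossible below
    1. *)
Lemma fan_line_origin (a b t s : R) : 0 < t < 1 -> 0 < s < 1 -> t != s ->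
  a * (1 + t ^+ 2) + b * t = 0 -> a * (1 + s ^+ 2) + b * s = 0 -> (a, b) = (0, 0).
Proof.
move=> t01 s01 ts et es.
have : a * ((s - t) * (1 - s * t)) = 0.
  transitivity (s * (a * (1 + t ^+ 2) + b * t) - t * (a * (1 + s ^+ 2) + b * s)); first by ring.
  by rewrite et es !mulr0 subrr.
have st : s * t < 1 by nra.
move=> /eqP; rewrite !mulf_eq0 subr_eq0 [s == t]eq_sym (negPf ts) subr_eq0 [1 == _]gt_eqF//= ?orbF => /eqP a0.
move: et; rewrite a0 mul0r add0r => /eqP; rewrite mulf_eq0 [t == 0]gt_eqF ?orbF; last by case/andP: t01.
by move=> /eqP->.
Qed.

Lemma fan_line (a b c t s u : R) : t != s -> s != u -> t != u ->
  a * (1 + t ^+ 2) + b * t = c -> a * (1 + s ^+ 2) + b * s = c ->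
  a * (1 + u ^+ 2) + b * u = c -> (a, b) = (0, 0).
Proof.
move=> ts su tu et es eu.
have e1 : (t - s) * (a * (t + s) + b) = 0.
  by transitivity (a * (1 + t ^+ 2) + b * t - (a * (1 + s ^+ 2) + b * s)); [ring|rewrite et es subrr].
have e2 : (s - u) * (a * (s + u) + b) = 0.
  by transitivity (a * (1 + s ^+ 2) + b * s - (a * (1 + u ^+ 2) + b * u)); [ring|rewrite eu es subrr].
move/eqP: e1; rewrite mulf_eq0 subr_eq0 (negPf ts) /= => /eqP e1.
move/eqP: e2; rewrite mulf_eq0 subr_eq0 (negPf su) /= => /eqP e2.
have /eqP : a * (t - u) = 0.
  by transitivity ((a * (t + s) + b) - (a * (s + u) + b)); [ring|rewrite e1 e2 subrr].
rewrite mulf_eq0 subr_eq0 (negPf tu) orbF => /eqP a0.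
by move: e1; rewrite a0 mul0r add0r => ->.
Qed.

Lemma fan_general_position h n : 0 < h < 1 -> general_position (fan h n).
Proof.
move=> /andP[h0 h1] p q r pS qS rS pq qr pr [a [b [c [ab [lp lq lr]]]]].
move/eqP: ab; apply.
have lt1 t : 0 < t <= h -> 0 < t < 1.
  by move=> /andP[-> /le_lt_trans]; apply.
have neq t s : (1 + t ^+ 2, t) != (1 + s ^+ 2, s) :> R * R -> t != s.
  by apply: contraNneq => ->.
case: (fan_pointP h0 pS) lp pq pr => [->|[t th ->]] /= lp pq pr;
case: (fan_pointP h0 qS) lq pq qr => [->|[s sh ->]] /= lq pq qr;
case: (fan_pointP h0 rS) lr pr qr => [->|[u uh ->]] /= lr pr qr;
  rewrite ?eqxx// in pq qr pr.
- move: lp; rewrite !mulr0 addr0 => c0; rewrite -c0 in lq lr.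
  by apply: (@fan_line_origin _ _ s u); rewrite ?lt1 ?neq.
- move: lq; rewrite !mulr0 addr0 => c0; rewrite -c0 in lp lr.
  by apply: (@fan_line_origin _ _ t u); rewrite ?lt1 ?neq.
- move: lr; rewrite !mulr0 addr0 => c0; rewrite -c0 in lq lp.
  by apply: (@fan_line_origin _ _ t s); rewrite ?lt1 ?neq.
- by apply: (@fan_line _ _ c t s u); rewrite ?neq.
Qed.

Lemma fan_dot h t s : 0 < h <= 1 -> 0 < t <= h -> 0 < s <= h -> s != t ->
  forall x y : R * R, x = (1 + t ^+ 2, t) -> y = (1 + s ^+ 2, s) ->
  dot ((0, 0) - x) (y - x) < enorm ((0, 0) - x) * enorm (y - x) * (6 * h).
Proof.
move=> /andP[h0 h1] /andP[t0 th] /andP[s0 sh] st x y xE yE.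
have nx : 1 <= enorm ((0, 0) - x).
  rewrite -[1]sqrtr1 ler_wsqrtr// /dot xE ?yE /=.
  have := sqr_ge0 (0 - t); have := sqr_ge0 t; nra.
have ny : `|s - t| <= enorm (y - x).
  rewrite -sqrtr_sqr ler_wsqrtr// /dot xE yE /=.
  by have := sqr_ge0 (1 + s ^+ 2 - (1 + t ^+ 2)); rewrite !expr2; lra.
have st0 : 0 < `|s - t| by rewrite normr_gt0 subr_eq0.
have dE : dot ((0, 0) - x) (y - x) = - (s - t) * ((1 + t ^+ 2) * (s + t) + t).
  by rewrite /dot xE yE /=; ring.
have k0 : 0 <= (1 + t ^+ 2) * (s + t) + t by nra.
(* With [t] and [s] at most [h <= 1], the left side is at most [2 * (2 * h) + h]. *)
have k5 : (1 + t ^+ 2) * (s + t) + t < 6 * h by nra.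
apply: (@le_lt_trans _ _ (`|s - t| * ((1 + t ^+ 2) * (s + t) + t))).
  by rewrite dE ler_wpM2r// -normrN ler_norm.
apply: (@lt_le_trans _ _ (`|s - t| * (6 * h))); first by rewrite ltr_pM2l.
rewrite ler_wpM2r//; first by rewrite mulr_ge0// ltW.
by apply: (le_trans ny); rewrite ler_peMl// (le_trans (normr_ge0 _) ny).
Qed.

Lemma fan_openness h n w (T : rel (fan h n)) : 0 < h < 1 ->
  3 * pi / 2 <= w <= 2 * pi -> 6 * h <= cos w ->
  plane_spanning_tree T -> (forall p, (degree T p <= n.-1)%N) -> (0 < n)%N ->
  openness T < w.
Proof.
move=> /andP[h0 h1] wB hw [[symT irrT _] conT _] degT n0.
pose o : fan h n := [` origin_fan h n]%fset.
(* The fan has [n.+1] points, so degree at most [n.-1] leaves a non-neighbour of [o]. A path to it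
   starts with [o], [y], [z], and the angle at [y] is the one sought. *)
have [x xo ox] : exists2 x, x != o & ~~ T o x.
  apply/exists_inP; apply: contraTT (degT o) => /exists_inPn oT.
  rewrite -ltnNge prednK//.
  have : (#|[set~ o]| <= degree T o)%N.
    apply/subset_leq_card/fintype.subsetP => x; rewrite !inE => xo.
    by have := oT x xo; rewrite negbK.
  apply: leq_trans; rewrite cardsC1 -cardfE (card_fan _ h0).
  by [].
have [c pc xc] := connectP (conT o x).
move: xc; case: (shortenP pc) => -[|y [|z d]] /=.
- by move=> _ _ _ e; rewrite e eqxx in xo.
- by rewrite andbT => oy _ _ e; rewrite e oy in ox.
move=> /and3P[oy yz _] /andP[]; rewrite !inE !negb_or => /and3P[noy noz _] /andP[/andP[nyz _] _] _ _.
have yo : T y o by rewrite symT.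
apply: (@le_lt_trans _ _ (vertex_openness T y)); first exact: bigmin_le.
apply: (@vertex_openness_lt _ _ _ _ o z) => //.
have nval (u v : fan h n) : u != v -> val u != val v by rewrite (inj_eq val_inj).
have [y0|[t tB yE]] := fan_pointP h0 (valP y).
  by have := nval _ _ noy; rewrite y0 eqxx.
have [z0|[s sB zE]] := fan_pointP h0 (valP z).
  by have := nval _ _ noz; rewrite z0 eqxx.
have st : s != t by apply: contraTneq (nval _ _ nyz) => st; rewrite yE zE st eqxx.
have hB : 0 < h <= 1 by rewrite h0 ltW.
apply: lt_le_trans (fan_dot hB tB sB st yE zE) _.
by rewrite ler_wpM2l// mulr_ge0 ?sqrtr_ge0.
Qed.

End Fan.

Theorem theorem3 (R : realType) :
  (forall (n : nat) (S : {fset R * R}),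
      (1 <= n)%N -> #|` S|%fset = n -> general_position S ->
      exists T : rel S,
        [/\ plane_spanning_tree T,
            is_open T (3 * pi / 2)
          & forall p : S, (degree T p <= 3)%N])
  /\
  (forall (n : nat) (eps : R), (1 <= n)%N -> 0 < eps ->
      exists S : {fset R * R},
        [/\ #|` S|%fset = n,
            general_position S
          & forall T : rel S,
              plane_spanning_tree T ->
              (forall p : S, (degree T p + 2 <= n)%N) ->
              openness T < 3 * pi / 2 + eps]).
Proof.
split=> [n S n1 Sn gp|n eps n1 eps0].
  have [T [[[sym irr _] pl con ac] nob deg]] : exists T, good T [set: S].
    apply: (good_exists gp); rewrite -cards_eq0 cardsT -lt0n -cardfE Sn.
    exact: n1.
  exists T; split=> //; last exact: is_open_nonobtuse.
  by split=> // x y; apply: con; rewrite inE.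
(* Capping by 1, which is at most [pi / 2], keeps [3 * pi / 2 + d] below [2 * pi]. *)
pose d := Num.min eps 1; have p2 := pihalf_ge1 R.
have d0 : 0 < d by rewrite lt_min eps0 ltr01.
have d1 : d <= 1 by rewrite ge_min lexx orbT.
have de : d <= eps by rewrite ge_min lexx.
have sd : 0 < sin d by apply: sin_gt0_pi; lra.
have cw : cos (3 * pi / 2 + d) = sin d.
  have -> : 3 * pi / 2 + d = d + pi / 2 + pi by lra.
  by rewrite cosDpi cosDpihalf opprK.
have s1 := sin_le1 d.
(* With this [h], [6 * h] equals the cosine of [3 * pi / 2 + d]; the origin is the [n]-th point. *)
exists (fan (sin d / 6) n.-1); split.
- by rewrite card_fan ?prednK// divr_gt0.
- by apply: fan_general_position; lra.
move=> T tT dT; apply: (@lt_le_trans _ _ (3 * pi / 2 + d)); last by lra.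
apply: (@fan_openness _ (sin d / 6) n.-1) => //.
- by lra.
- by lra.
- by rewrite cw; lra.
- by move=> p; have := leq_sub2r 2 (dT p); rewrite addnK subn2.
(* The degree hypothesis at the origin forces [n >= 2]; for [n = 1] the claim is vacuous. *)
- by rewrite -subn1 subn_gt0; apply: leq_trans (dT [` origin_fan _ _]%fset); exact: leq_addl.
Qed.
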